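(* For $n\ge2$, the mean number of distinct (adjacent) pairs in the word $Z_1,\ldots,Z_n$ is exactly $$\mathbb{E}[X^{(n)}]=\sum_{i=1}^{\infty}\sum_{j\ne i}\Bigg[1-\frac{(2P_iP_j)^{n+1}}{\sqrt{1-4P_iP_j}}\bigg(\frac{1}{\big(1-\sqrt{1-4P_iP_j}\big)^{n+1}}-\frac{1}{\big(1+\sqrt{1-4P_iP_j}\big)^{n+1}}\bigg)\Bigg]$$ $$+\sum_{i=1}^{\infty}\Bigg[1-\Big(\frac12-\frac{1+P_i}{2R_i}\Big)\Big(\frac{-2P_i(1-P_i)}{1-P_i+R_i}\Big)^{n}-\Big(\frac12+\frac{1+P_i}{2R_i}\Big)\Big(\frac{-2P_i(1-P_i)}{1-P_i-R_i}\Big)^{n}\Bigg],$$ where $R_i:=\sqrt{(1-P_i)(1+3P_i)}$. For $n<2$ we have $\mathbb{E}[X^{(n)}]=0$.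
   Context: Let $0<p<1$, $q=1-p$. $Z_1,Z_2,\ldots$ are i.i.d. geometric random variables, $\mathbb{P}(Z_k=i)=P_i:=p\,q^{i-1}$ for $i\ge1$. For $i,j\ge1$, $X_{i,j}^{(n)}$ is the indicator of the event that $Z_k=i$, $Z_{k+1}=j$ for some $1\le k\le n-1$, and $X^{(n)}:=\sum_{i\ge1}\sum_{j\ge1}X_{i,j}^{(n)}$ is the total number of distinct adjacent pairs in $Z_1,\ldots,Z_n$. *)

(* Defs.v *)
From HB Require Import structures.
From mathcomp Require Export all_boot all_order all_algebra.
From mathcomp Require Export finmap.
From mathcomp Require Export all_classical all_reals all_analysis.

Set Implicit Arguments.
Unset Strict Implicit.
Unset Printing Implicit Defensive.

Import Order.TTheory GRing.Theory Num.Theory.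
Import numFieldNormedType.Exports.

Local Open Scope classical_set_scope.
Local Open Scope ring_scope.

Definition mutually_independent (d d' : measure_display) (T : measurableType d)
    (T' : measurableType d') (R : realType) (P : probability T R)
    (I : choiceType) (D : set I) (X : I -> {RV P >-> T'}) : Prop :=
  forall (J : {fset I}) (A : I -> set T'),
    [set` J] `<=` D -> (forall k, k \in J -> measurable (A k)) ->
    P (\bigcap_(k in [set` J]) (X k @^-1` A k)) =
    (\prod_(k <- J) P (X k @^-1` A k))%E.

Definition geom_pmf (R : realType) (p : R) (i : nat) : R := p * (1 - p) ^+ i.-1.

(* The letters are Z 1, Z 2, ...; nothing is required of Z 0.  The point mass
   at 0 is not mentioned: it vanishes since the masses at i >= 1 sum to 1. *)
Definition iid_geometric (d : measure_display) (T : measurableType d)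
    (R : realType) (P : probability T R) (p : R)
    (Z : nat -> {RV P >-> nat}) : Prop :=
  mutually_independent [set k | (1 <= k)%N] Z /\
  forall k i, (1 <= k)%N -> (1 <= i)%N ->
    P (Z k @^-1` [set i]) = (geom_pmf p i)%:E.

Definition pair_event (T : Type) (Z : nat -> T -> nat) (n i j : nat) : set T :=
  [set w | exists k, [/\ (1 <= k <= n.-1)%N, Z k w = i & Z k.+1 w = j]].

(* For each outcome only finitely many terms are nonzero, so that the
   real-valued series below are finite sums. *)
Definition distinct_pairs (T : Type) (R : realType) (Z : nat -> T -> nat)
    (n : nat) (w : T) : R :=
  \big[+%R/0 : R]_(1 <= i <oo) \big[+%R/0 : R]_(1 <= j <oo)
    (\1_(pair_event Z n i j) w : R).

Definition offdiag_term (R : realType) (p : R) (n i j : nat) : R :=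
  let Pij := geom_pmf p i * geom_pmf p j in
  let s := Num.sqrt (1 - 4 * Pij) in
  1 - (2 * Pij) ^+ n.+1 / s * (1 / (1 - s) ^+ n.+1 - 1 / (1 + s) ^+ n.+1).

Definition diag_term (R : realType) (p : R) (n i : nat) : R :=
  let Pi := geom_pmf p i in
  let Ri := Num.sqrt ((1 - Pi) * (1 + 3 * Pi)) in
  1 - (1 / 2 - (1 + Pi) / (2 * Ri)) * (- 2 * Pi * (1 - Pi) / (1 - Pi + Ri)) ^+ n
    - (1 / 2 + (1 + Pi) / (2 * Ri)) * (- 2 * Pi * (1 - Pi) / (1 - Pi - Ri)) ^+ n.

(* Main.v *)
(** By linearity the mean is the sum over (i, j) of the probability that the
    pair ij occurs.  Let u_n be the probability that it does not occur in
    Z_1, ..., Z_n, and v_n the probability that moreover Z_n = i.  Appending one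
    independent letter gives
      u_(n+1) = u_n - P_j v_n,   v_(n+1) = P_i (u_n - [i = j] v_n),
    so u satisfies a linear recurrence of order two, whose characteristic roots
    are (1 +- s) / 2 with s^2 = 1 - 4 P_i P_j if i <> j, and
    (1 - P_i +- R_i) / 2 if i = j.  The powers in the stated formula are powers
    of these roots, each rewritten as the product of both over the other. *)

Require Import Defs.
From mathcomp Require Import ring lra zify measurable_realfun.
Set Implicit Arguments.
Unset Strict Implicit.
Unset Printing Implicit Defensive.

Import Order.TTheory GRing.Theory Num.Theory.
Local Open Scope ring_scope.

(** * Two-step linear recurrences and the closed forms of both summands *)

Lemma linear_recurrence2_unique (V : pzRingType) (a b : V) (u v : nat -> V) :
  u 0 = v 0 -> u 1%N = v 1%N ->
  (forall k, u k.+2 = a * u k.+1 + b * u k) ->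
  (forall k, v k.+2 = a * v k.+1 + b * v k) -> u =1 v.
Proof.
move=> uv0 uv1 ur vr k.
suff [] : u k = v k /\ u k.+1 = v k.+1 by [].
by elim: k => [//|k [IHk IHk1]]; rewrite ur vr IHk IHk1.
Qed.

Section closed_forms.
Context {R : realType} (p : R).
Hypothesis hp : 0 < p < 1.

Let p_gt0 : 0 < p. Proof. by case/andP: hp. Qed.
Let q_gt0 : 0 < 1 - p. Proof. by rewrite subr_gt0; case/andP: hp. Qed.
Let q_lt1 : 1 - p < 1. Proof. by rewrite ltrBlDr ltrDl. Qed.

Lemma geom_pmf_gt0 i : 0 < geom_pmf p i.
Proof. by rewrite /geom_pmf mulr_gt0 ?exprn_gt0. Qed.

Lemma geom_pmf_le i : geom_pmf p i <= p.
Proof.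
by rewrite /geom_pmf ler_piMr ?(ltW p_gt0)// exprn_ile1// ltW.
Qed.

Lemma geom_pmf_lt1 i : geom_pmf p i < 1.
Proof. by apply: le_lt_trans (geom_pmf_le i) _; case/andP: hp. Qed.

Lemma geom_pmf_le2 i : (2 <= i)%N -> geom_pmf p i <= p * (1 - p).
Proof.
case: i => [//|[//|i]] _; rewrite /geom_pmf/= exprS mulrA.
by rewrite ler_piMr ?exprn_ile1 ?mulr_ge0// ltW.
Qed.

(** One of two distinct indices is at least 2, so the product is at most [p ^+ 2 * (1 - p)], and
    [4 * p * (1 - p) <= 1]. This makes the root [s] of the off-diagonal term positive. *)
Lemma geom_pmf_mul_lt i j : (1 <= i)%N -> (1 <= j)%N -> i != j ->
  4 * (geom_pmf p i * geom_pmf p j) < 1.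
Proof.
move=> i1 j1 ij; wlog ltij : i j i1 j1 ij / (i < j)%N.
  move=> H; case: (ltngtP i j) => [|ltji|eij]; first exact: H.
    by rewrite [X in 4 * X]mulrC; apply: H => //; rewrite eq_sym.
  by rewrite eij eqxx in ij.
have j2 : (2 <= j)%N by exact: leq_trans ltij.
have := geom_pmf_le i; have := geom_pmf_le2 j2.
have := geom_pmf_gt0 i; have := geom_pmf_gt0 j.
move: (geom_pmf p i) (geom_pmf p j) => x y x0 y0 yp xp.
have : x * y <= p * (p * (1 - p)) by apply: ler_pM => //; exact: ltW.
have : 0 <= p * (2 * p - 1) ^+ 2 by rewrite mulr_ge0 ?sqr_ge0 ?ltW.
by case/andP: hp => _; nra.
Qed.

(** Here [u k] stands for the avoidance probability in words of length [k.+1], whence the shift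
    between [n.+1] and [u n]. *)
Lemma offdiag_closed_form (u : nat -> R) n i j :
  (1 <= i)%N -> (1 <= j)%N -> i != j ->
  u 0 = 1 -> u 1%N = 1 - geom_pmf p i * geom_pmf p j ->
  (forall k, u k.+2 = u k.+1 - geom_pmf p i * geom_pmf p j * u k) ->
  offdiag_term p n.+1 i j = 1 - u n.
Proof.
move=> i1 j1 ij u0 u1 ur; rewrite /offdiag_term/=.
have := geom_pmf_mul_lt i1 j1 ij.
have := mulr_gt0 (geom_pmf_gt0 i) (geom_pmf_gt0 j).
move: u1 ur; move: (_ * geom_pmf p j) => t u1 ur t0 t4.
set s := Num.sqrt _.
have s2 : s ^+ 2 = 1 - 4 * t by rewrite sqr_sqrtr; lra.
have s0 : 0 < s by rewrite sqrtr_gt0; lra.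
have s1 : s < 1 by nra.
have sN0 : s != 0 by rewrite gt_eqF.
(* Substituting this for [t] leaves rational identities in [s]. *)
have tE : t = (1 - s) * (1 + s) / 4 by nra.
have e1 : 2 * t / (1 - s) = (1 + s) / 2.
  by rewrite tE; field; lra.
have e2 : 2 * t / (1 + s) = (1 - s) / 2.
  by rewrite tE; field; lra.
rewrite mulrBr !mulrA !(mulrAC _ s^-1) mulr1 -!expr_div_n e1 e2.
rewrite -mulrBl; congr (1 - _).
pose v k := (((1 + s) / 2) ^+ k.+2 - ((1 - s) / 2) ^+ k.+2) / s.
apply/esym/(@linear_recurrence2_unique _ 1 (- t) u v).
- by rewrite u0 /v; field.
- by rewrite u1 /v tE; field.
- by move=> k; rewrite ur mul1r mulNr.
- by move=> k; rewrite /v tE !exprS; field.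
Qed.

Lemma diag_closed_form (u : nat -> R) n i :
  u 0 = 1 -> u 1%N = 1 - geom_pmf p i ^+ 2 ->
  (forall k, u k.+2 = (1 - geom_pmf p i) * u k.+1 +
                      geom_pmf p i * (1 - geom_pmf p i) * u k) ->
  diag_term p n.+1 i = 1 - u n.
Proof.
rewrite /diag_term/=.
have := geom_pmf_gt0 i; have := geom_pmf_lt1 i.
move: (geom_pmf p i) => t t1 t0 u0 u1 ur.
set r := Num.sqrt _.
have r2 : r ^+ 2 = (1 - t) * (1 + 3 * t) by rewrite sqr_sqrtr//; nra.
have r0 : 0 < r by rewrite sqrtr_gt0; nra.
(* Since [r ^+ 2 - (1 - t) ^+ 2 = 4 * t * (1 - t) > 0]; this keeps the denominator [1 - t - r]
   nonzero. *)
have rt : 1 - t < r by nra.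
have rN0 : r != 0 by rewrite gt_eqF.
have tE : t * (1 - t) = (r - (1 - t)) * (1 - t + r) / 4 by nra.
have e1 : - 2 * t * (1 - t) / (1 - t + r) = (1 - t - r) / 2.
  by rewrite -mulrA -mulrA [t * _]mulrA tE; field; lra.
have e2 : - 2 * t * (1 - t) / (1 - t - r) = (1 - t + r) / 2.
  by rewrite -mulrA -mulrA [t * _]mulrA tE; field; lra.
rewrite e1 e2 -addrA -opprD; congr (1 - _).
pose v k := (1 / 2 - (1 + t) / (2 * r)) * ((1 - t - r) / 2) ^+ k.+1 +
  (1 / 2 + (1 + t) / (2 * r)) * ((1 - t + r) / 2) ^+ k.+1.
apply/esym/(@linear_recurrence2_unique _ (1 - t) (t * (1 - t)) u v) => //.
- by rewrite u0 /v; field.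
- by rewrite u1 /v; field : r2.
- by move=> k; rewrite /v tE !exprS; field.
Qed.
End closed_forms.

(** * Independence of past events from later letters *)

Local Open Scope classical_set_scope.
Local Open Scope ereal_scope.

Lemma probability_setD d (T : measurableType d) (R : realType)
    (P : probability T R) (A B : set T) :
  measurable A -> measurable B -> B `<=` A -> P (A `\` B) = P A - P B.
Proof.
move=> mA mB BA; rewrite measureD ?(setIidr BA)//.
by rewrite (le_lt_trans (probability_le1 _ _)) ?ltry.
Qed.

Section independence.
Context d (T : measurableType d) (R : realType) (P : probability T R).
Context (Z : nat -> {RV P >-> nat}).
Hypothesis Zind : mutually_independent [set k | (1 <= k)%N] Z.

Let measurable_preimage k (B : set nat) : measurable (Z k @^-1` B).
Proof. exact: measurable_funPTI. Qed.

(* Replaces "E belongs to the sigma-algebra of Z 1, ..., Z m". *)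
Definition indep_future (m : nat) (E : set T) :=
  measurable E /\ forall (J : {fset nat}) (A : nat -> set nat),
    (forall k, k \in J -> (m < k)%N) ->
    P (E `&` \bigcap_(k in [set` J]) (Z k @^-1` A k)) =
    P E * \prod_(k <- J) P (Z k @^-1` A k).

Lemma indep_futureT m : indep_future m setT.
Proof.
split=> [|J A Jm]; first exact: measurableT.
rewrite setTI probability_setT mul1e; apply: Zind => // k /= kJ.
exact: leq_trans (Jm _ kJ).
Qed.

Lemma indep_futureW m m' E : (m <= m')%N ->
  indep_future m E -> indep_future m' E.
Proof.
move=> mm' [mE HE]; split=> // J A Jm'.
by apply: HE => k /Jm'; exact: leq_ltn_trans.
Qed.

Let bigcap_letter (A : nat -> set nat) m :
  \bigcap_(k in [set` [fset m]%fset]) (Z k @^-1` A k) = Z m @^-1` A m.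
Proof. by rewrite set_fset1 bigcap_set1. Qed.

Lemma indep_future_letter m E (B : set nat) : indep_future m E ->
  P (E `&` Z m.+1 @^-1` B) = P E * P (Z m.+1 @^-1` B).
Proof.
move=> [_ /(_ [fset m.+1]%fset (fun=> B))].
by rewrite bigcap_letter big_seq_fset1; apply=> k; rewrite inE => /eqP ->.
Qed.

(** The event on letter [m.+1] is moved into the intersection over future letters, where the
    hypothesis on [E] applies to the index set enlarged by [m.+1]; its factor is then regrouped with
    that of [E]. *)
Lemma indep_future_next m E (B : set nat) : indep_future m E ->
  indep_future m.+1 (E `&` Z m.+1 @^-1` B).
Proof.
move=> HE; have [mE HE'] := HE; split; first exact: measurableI.
move=> J A Jm.
have mJ : m.+1 \notin J by apply/negP => /Jm; rewrite ltnn.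
pose A' k := if k == m.+1 then B else A k.
have A'J k : k \in J -> A' k = A k.
  by rewrite /A'; case: eqP => // -> /negPn; rewrite mJ.
have -> : \bigcap_(k in [set` J]) (Z k @^-1` A k) =
          \bigcap_(k in [set` J]) (Z k @^-1` A' k).
  by apply: eq_bigcapr => k /= /A'J ->.
rewrite (eq_big_seq (fun k => P (Z k @^-1` A' k))) => [|k /A'J -> //].
have := HE' (m.+1 |` J)%fset A'.
rewrite bigcap_fsetU1 big_fsetU1//= {1 3}/A' eqxx setIA muleA.
rewrite -indep_future_letter//; apply => k /fset1UP[->//|/Jm].
exact: ltnW.
Qed.

(** Both sides of the product formula are subtractive on nested events. Nestedness matters, as such
    a class of events need not be closed under intersection. *)
Lemma indep_futureD m E F : F `<=` E ->
  indep_future m E -> indep_future m F -> indep_future m (E `\` F).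
Proof.
move=> FE [mE HE] [mF HF]; split; first exact: measurableD.
move=> J A Jm; set C := \bigcap_(k in _) _.
have mC : measurable C by apply: fin_bigcap_measurable.
have -> : (E `\` F) `&` C = (E `&` C) `\` (F `&` C).
  by apply/seteqP; split => x /=; tauto.
rewrite probability_setD//; [|exact: measurableI..|exact: setSI].
rewrite probability_setD// HE// HF// -muleBl ?fin_num_adde_defr ?fin_num_measure//.
by apply: prode_fin_num => k _; rewrite fin_num_measure.
Qed.

(** * Recurrences for the probability of avoiding a fixed pair *)

Section avoidance.
Context (i j : nat).

Let avoid n : set T := ~` pair_event Z n i j.
Let avoid_end n : set T := avoid n `&` Z n @^-1` [set i].

Let avoid1 : avoid 1 = setT.
Proof.
by apply/seteqP; split => // w _ [k] [/andP[k1 /(leq_trans k1)]].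
Qed.

(** The new letter adds only position [n.+1], so the outcomes to discard are those that end with [i]
    and continue with [j]. *)
Let avoidS n :
  avoid n.+2 = avoid n.+1 `\` (avoid_end n.+1 `&` Z n.+2 @^-1` [set j]).
Proof.
apply/seteqP; split => [w Nw|w [Nw Hw] [k [/andP[k1 +] zi zj]]].
  split; first by move=> [k [/andP[k1 kn] zi zj]]; apply: Nw; exists k;
    rewrite k1 ltnW.
  by move=> [[_ zi] zj]; apply: Nw; exists n.+1; rewrite /= leqnn.
rewrite /= leq_eqVlt => /orP[/eqP kn|kn]; last first.
  by apply: Nw; exists k; rewrite k1.
by subst k; apply: Hw.
Qed.

(** A new letter [i] can complete the pair only if [i = j]. In this form the new letter is confined
    to a separate factor, so independence applies. *)
Let avoid_endS n : avoid_end n.+2 =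
  (avoid n.+1 `\` (if i == j then avoid_end n.+1 else set0)) `&`
  Z n.+2 @^-1` [set i].
Proof.
rewrite /avoid_end avoidS /avoid_end; apply/seteqP; split => w /=.
  by case: eqVneq => [ij|ij] /=; rewrite -?ij; tauto.
case: eqVneq => [ij|/eqP ij] /=; rewrite -?ij; first tauto.
by move=> [[N _] zi]; split=> //; split=> // -[_]; rewrite zi.
Qed.

Let indep_avoid n : indep_future n.+1 (avoid n.+1) /\
  indep_future n.+1 (avoid_end n.+1).
Proof.
elim: n => [|n [IH IHe]].
  rewrite /avoid_end avoid1; split; first exact: indep_futureT.
  exact/indep_future_next/indep_futureT.
rewrite avoid_endS avoidS; split.
  apply: indep_futureD => [w [[]]//||]; last exact: indep_future_next.
  exact: indep_futureW IH.
apply: indep_future_next; case: ifP => _; last by rewrite setD0.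
by apply: indep_futureD => // w [].
Qed.

Context (a b : R).
Hypothesis Pi : forall k, (1 <= k)%N -> P (Z k @^-1` [set i]) = a%:E.
Hypothesis Pj : forall k, (1 <= k)%N -> P (Z k @^-1` [set j]) = b%:E.

(** Index [k] means word length [k.+1]: the recursion starts from one letter, [Z 0] being outside
    the word. *)
Let u k := fine (P (avoid k.+1)).
Let v k := fine (P (avoid_end k.+1)).

Let uE k : P (avoid k.+1) = (u k)%:E.
Proof. by rewrite fineK// fin_num_measure//; have [[]] := indep_avoid k. Qed.

Let vE k : P (avoid_end k.+1) = (v k)%:E.
Proof. by rewrite fineK// fin_num_measure//; have [_ []] := indep_avoid k. Qed.

Let u0 : u 0%N = 1%R.
Proof. by rewrite /u avoid1 probability_setT. Qed.

Let v0 : v 0%N = a.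
Proof. by rewrite /v /avoid_end avoid1 setTI Pi. Qed.

Let uS k : u k.+1 = (u k - b * v k)%R.
Proof.
have [Hu Hv] := indep_avoid k.
apply: EFin_inj; rewrite -uE avoidS probability_setD; first last.
- by move=> w [[]].
- exact: (indep_future_next _ Hv).1.
- exact: Hu.1.
by rewrite indep_future_letter// uE vE Pj// mulrC EFinB.
Qed.

Let vS k : v k.+1 = (a * (u k - (i == j)%:R * v k))%R.
Proof.
have [Hu Hv] := indep_avoid k.
apply: EFin_inj; rewrite -vE avoid_endS; case: eqVneq => _.
  have H : avoid_end k.+1 `<=` avoid k.+1 by move=> w [].
  rewrite indep_future_letter; last exact: indep_futureD.
  rewrite Pi// probability_setD//; [|exact: Hu.1|exact: Hv.1].
  by rewrite uE vE mul1r muleC.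
by rewrite setD0 indep_future_letter// uE Pi// mul0r subr0 muleC.
Qed.

Lemma measurable_pair_event n : measurable (pair_event Z n.+1 i j).
Proof.
by rewrite -[X in measurable X]setCK; exact/measurableC/(indep_avoid n).1.1.
Qed.

(** The relation [b * v k = u k - u k.+1] eliminates [v] without dividing by [b]. The test [i == j]
    enters as a number, so both cases share one recurrence. *)
Lemma probability_pair_event : exists u : nat -> R, [/\
  u 0%N = 1%R, u 1%N = (1 - a * b)%R,
  forall k, u k.+2 = ((1 - (i == j)%:R * a) * u k.+1 +
                      a * ((i == j)%:R - b) * u k)%R &
  forall n, P (pair_event Z n.+1 i j) = (1 - u n)%:E].
Proof.
exists u; split=> [||k|n].
- exact: u0.
- by rewrite uS u0 v0 mulrC.
- by rewrite uS vS uS; ring.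
- have mA := (indep_avoid n).1.1.
  by rewrite -[pair_event _ _ _ _]setCK probability_setC// uE.
Qed.

End avoidance.
End independence.

Lemma probability_pair_event_geometric d (T : measurableType d) (R : realType)
    (P : probability T R) (p : R) (Z : nat -> {RV P >-> nat}) n i j :
  (0 < p < 1)%R -> iid_geometric p Z -> (1 <= i)%N -> (1 <= j)%N ->
  P (pair_event Z n.+1 i j) =
  (if j == i then diag_term p n.+1 i else offdiag_term p n.+1 i j)%:E.
Proof.
move=> hp [Zind Zgeom] i1 j1.
have Pi k (k1 : (1 <= k)%N) := Zgeom k i k1 i1.
have Pj k (k1 : (1 <= k)%N) := Zgeom k j k1 j1.
have [u [u0 u1 ur ->]] := probability_pair_event Zind Pi Pj.
congr (_%:E); move: u1 ur; case: eqVneq => [<-|ij] u1 ur.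
  rewrite (diag_closed_form hp (u := u))// => k; rewrite ur/=; ring.
rewrite (offdiag_closed_form hp (u := u))// => k; rewrite ur/=; ring.
Qed.

(** * The expectation as a double series of probabilities *)

(** The partial sums are constant from [maxn m N] on, so the real series converges and its limit
    commutes with [EFin]. *)
Lemma EFin_lim_big_nat (R : realType) m N (f : nat -> R) :
  (forall k, (N <= k)%N -> f k = 0%R) ->
  (\big[+%R/0%R]_(m <= k <oo) f k)%:E = \sum_(m <= k <oo) (f k)%:E.
Proof.
move=> f0.
have f_cst : \forall n \near \oo,
    (\sum_(m <= k < n) f k)%R = (\sum_(m <= k < maxn m N) f k)%R.
  exists (maxn m N) => // n /= Nn.
  rewrite (big_cat_nat (leq_maxl m N) Nn)/= [X in (_ + X)%R]big1_seq ?addr0// => k.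
  by rewrite mem_index_iota => /andP[_ /andP[/(leq_trans (leq_maxr m N))/f0]].
rewrite -EFin_lim; first by apply: congr_lim; apply/funext => n; rewrite sumEFin.
exact: is_cvg_near_cst f_cst.
Qed.

Lemma EFin_distinct_pairs (T : Type) (R : realType) (Z : nat -> T -> nat) n w :
  (distinct_pairs R Z n w)%:E =
  \sum_(1 <= i <oo) \sum_(1 <= j <oo) (\1_(pair_event Z n i j) w)%:E.
Proof.
(* A strict upper bound on the letters of this outcome: no pair with a coordinate at least [N]
   occurs. *)
pose N := (\max_(k < n.+1) Z k w).+1.
have Nmax i j : (N <= i)%N || (N <= j)%N -> \1_(pair_event Z n i j) w = 0%R :> R.
  move=> Nij; rewrite indicE memNset// => -[k [/andP[k1 kn] zi zj]].
  have ZN l : (l < n.+1)%N -> (Z l w < N)%N.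
    by move=> ln; exact: (leq_bigmax (Ordinal ln)).
  have nk : (k.+1 < n.+1)%N by lia.
  by case/orP: Nij; rewrite -?zi -?zj leqNgt ZN// ltnW.
rewrite (@EFin_lim_big_nat _ _ N) => [|i Ni]; last first.
  apply: EFin_inj; rewrite (@EFin_lim_big_nat _ _ 0) => [|j _].
    by rewrite eseries0// => j _ _; rewrite Nmax ?Ni.
  by rewrite Nmax ?Ni.
apply: eq_eseriesr => i _; apply: (@EFin_lim_big_nat _ _ N) => j Nj.
by rewrite Nmax ?Nj ?orbT.
Qed.

Section integral_nneseries_from.
Context d (T : measurableType d) (R : realType) (mu : {measure set T -> \bar R}).
Context (f : nat -> T -> \bar R) (m : nat).
Hypothesis mf : forall k, (m <= k)%N -> measurable_fun setT (f k).
Hypothesis f0 : forall k x, (m <= k)%N -> 0 <= f k x.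

(** Padding with zeros below [m] gives a series over all naturals, although [f] is constrained only
    from [m] on. *)
Let eseries_from (g : nat -> \bar R) :
  \sum_(m <= k <oo) g k = \sum_(k <oo) (if (m <= k)%N then g k else 0).
Proof.
apply: congr_lim; apply/funext => n; rewrite -big_mkcond.
by rewrite [LHS](big_nat_widenl _ 0%N).
Qed.

Lemma measurable_fun_nneseries_from :
  measurable_fun setT (fun x => \sum_(m <= k <oo) f k x).
Proof.
under eq_fun do rewrite eseries_from.
apply: (@ge0_emeasurable_sum _ _ _ _ _ xpredT) => [k x _ _|k _].
  by case: ifP => // /f0.
case: leqP => [/mf//|_]; exact: measurable_cst.
Qed.

Lemma integral_nneseries_from :
  \int[mu]_x (\sum_(m <= k <oo) f k x) = \sum_(m <= k <oo) \int[mu]_x f k x.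
Proof.
under eq_integral do rewrite eseries_from.
rewrite integral_nneseries//.
- rewrite eseries_from; apply: eq_eseriesr => k _; case: ifP => // _.
  exact: integral0.
- by move=> k; case: leqP => [/mf//|_]; exact: measurable_cst.
- by move=> k x _; case: ifP => // /f0.
Qed.
End integral_nneseries_from.

Lemma expectation_distinct_pairs d (T : measurableType d) (R : realType)
    (P : probability T R) (Z : nat -> T -> nat) n :
  (forall i j, measurable (pair_event Z n i j)) ->
  'E_P[distinct_pairs R Z n] =
  \sum_(1 <= i <oo) \sum_(1 <= j <oo) P (pair_event Z n i j).
Proof.
move=> mZ; rewrite unlock; under eq_integral do rewrite EFin_distinct_pairs.
have mI i j : measurable_fun setT (fun w => (\1_(pair_event Z n i j) w)%:E : \bar R).
  by apply/measurable_EFinP; exact: measurable_indic.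
rewrite integral_nneseries_from.
- apply: eq_eseriesr => i _; rewrite integral_nneseries_from//.
  by apply: eq_eseriesr => j _; rewrite integral_indic// setIT.
- by move=> i _; apply: measurable_fun_nneseries_from.
- by move=> i w _; apply: nneseries_ge0.
Qed.

Theorem theorem5p4 (d : measure_display) (T : measurableType d) (R : realType)
    (P : probability T R) (p : R) (Z : nat -> {RV P >-> nat})
    (hp : (0 < p < 1)%R) (hZ : iid_geometric p Z) (n : nat) :
  ((2 <= n)%N ->
    'E_P[distinct_pairs R Z n] =
      (\sum_(1 <= i <oo) \sum_(1 <= j <oo | j != i) (offdiag_term p n i j)%:E)
      + (\sum_(1 <= i <oo) (diag_term p n i)%:E)) /\
  ((n < 2)%N -> 'E_P[distinct_pairs R Z n] = 0).
Proof.
split=> [|n2]; last first.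
  rewrite unlock; apply: integral0_eq => w _; rewrite EFin_distinct_pairs.
  apply: eseries0 => i _ _; apply: eseries0 => j _ _.
  by rewrite indicE memNset// => -[k [? _ _]]; lia.
case: n => // n _.
rewrite expectation_distinct_pairs; last first.
  by move=> i j; exact: (measurable_pair_event hZ.1).
have Pij i j := @probability_pair_event_geometric _ _ _ P p Z n i j hp hZ.
(* Nonnegativity comes from the terms being probabilities, not from the formulas; it justifies
   adding the series termwise. *)
have diag_ge0 i : (1 <= i)%N -> 0 <= (diag_term p n.+1 i)%:E.
  by move=> i1; have := Pij i i i1 i1; rewrite eqxx => <-.
have offdiag_ge0 i j : (1 <= i)%N -> (1 <= j)%N -> j != i ->
    0 <= (offdiag_term p n.+1 i j)%:E.
  by move=> i1 j1 ij; have := Pij i j i1 j1; rewrite (negbTE ij) => <-.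
rewrite -nneseriesD; last 2 first.
- by move=> i i1 _; apply: nneseries_ge0 => j j1; exact: offdiag_ge0.
- by move=> i i1 _; exact: diag_ge0.
apply: congr_lim; apply/funext => N; apply: eq_big_nat => i /andP[i1 _].
(* The diagonal term becomes a series over [j] supported at [j = i], to be added termwise to the
   off-diagonal inner series. *)
have diagE : (diag_term p n.+1 i)%:E =
    \sum_(1 <= j <oo | j == i) (diag_term p n.+1 i)%:E.
  apply/esym/(lim_near_cst (@ereal_hausdorff R)); exists i.+1 => // m /= im.
  by rewrite big_nat1_eq i1 im.
rewrite diagE [X in X + _]eseries_mkcond [X in _ + X]eseries_mkcond -nneseriesD.
- apply: congr_lim; apply/funext => m; apply: eq_big_nat => j /andP[j1 _].
  by rewrite Pij//; case: eqVneq => _; rewrite ?add0e ?adde0.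
- by move=> j j1 _; case: ifP => // /offdiag_ge0; apply.
- by move=> j _ _; case: ifP => // _; exact: diag_ge0.
Qed.
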